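(* Let $n,m,k$ be positive integers with $k\le m$, let $I=\{1,\dots,m\}$, $J=\{1,\dots,k\}$, and let ${\mathbf a}^1,\dots,{\mathbf a}^m\in\mathbb R^n$. Suppose that $\mathbf x=({\mathbf x}^1,\dots,{\mathbf x}^k)\in\mathbb R^{n\times k}$ has pairwise distinct components (${\mathbf x}^{j_1}\ne{\mathbf x}^{j_2}$ whenever $j_1\ne j_2$) and that $|J_i(\mathbf x)|=1$ for every $i\in I$. Put $I(j)=\{i\in I\mid{\mathbf a}^i\in A[{\mathbf x}^j]\}$ for $j\in J$. If $${\mathbf x}^j=\frac1{|I(j)|}\sum_{i\in I(j)}{\mathbf a}^i$$ for every $j\in J$ with $A[{\mathbf x}^j]\neq\emptyset$, and ${\mathbf x}^j\notin\mathcal A[\mathbf x]$ for every $j\in J$ with $A[{\mathbf x}^j]=\emptyset$, where $\mathcal A[\mathbf x]$ is the union of the closed balls $\bar B({\mathbf a}^p,\|{\mathbf a}^p-{\mathbf x}^q\|)$ over all $p\in I$, $q\in J$ satisfying $p\in I(q)$, then $\mathbf x$ is a nontrivial local solution of the problem (NS) defined in the context.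
   Context: $\mathbb R^n$ carries the Euclidean norm $\|\cdot\|$; $\bar B(\mathbf c,r)=\{\mathbf y\in\mathbb R^n\mid\|\mathbf y-\mathbf c\|\le r\}$. Elements of $\mathbb R^{n\times k}$ are written $\mathbf x=({\mathbf x}^1,\dots,{\mathbf x}^k)$ with ${\mathbf x}^j\in\mathbb R^n$. The data set is $A=\{{\mathbf a}^1,\dots,{\mathbf a}^m\}$ (an indexed system; repetitions are not excluded). (NS): minimize $f(\mathbf x)=\frac1m\sum_{i\in I}\big(\min_{j\in J}\|{\mathbf a}^i-{\mathbf x}^j\|^2\big)$ over all $\mathbf x\in\mathbb R^{n\times k}$. A local solution of (NS) is a local minimizer of $f$. A local solution $\mathbf x$ is called nontrivial if its components are pairwise distinct, i.e. ${\mathbf x}^{j_1}\ne{\mathbf x}^{j_2}$ whenever $j_1\neq j_2$. The attraction set of the component ${\mathbf x}^j$ is $A[{\mathbf x}^j]=\{{\mathbf a}^i\in A\mid\|{\mathbf a}^i-{\mathbf x}^j\|=\min_{q\in J}\|{\mathbf a}^i-{\mathbf x}^q\|\}$. For $i\in I$, $j\in J$: $h_{i,j}(\mathbf x)=\sum_{q\in J\setminus\{j\}}\|{\mathbf a}^i-{\mathbf x}^q\|^2$, $\varphi_i(\mathbf x)=\max_{j\in J}h_{i,j}(\mathbf x)$, and $J_i(\mathbf x)=\{j\in J\mid h_{i,j}(\mathbf x)=\varphi_i(\mathbf x)\}$. $|\Omega|$ denotes the number of elements of a finite set $\Omega$. *)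

(* Defs.v *)
From HB Require Import structures.
From mathcomp Require Import all_boot all_order all_algebra.
From mathcomp Require Import all_classical all_reals all_analysis.

Set Implicit Arguments.
Unset Strict Implicit.
Unset Printing Implicit Defensive.

Import Order.TTheory GRing.Theory Num.Theory.
Import numFieldNormedType.Exports.

Local Open Scope classical_set_scope.
Local Open Scope ring_scope.

(* An element x = (x^1, ..., x^k) of R^(n x k) is a matrix 'M[R]_(n, k) whose
   j-th column [col j x] is x^j. *)

Section FiniteExtrema.
Variables (R : realType) (k : nat).
Implicit Types (F : 'I_k -> R) (j : 'I_k).

(* The default element is itself a value of F when 0 < k (see the lemmas
   below); the value 0 obtained for k = 0 is irrelevant. *)
Definition min_over F : R := \big[Num.min/head 0 (codom F)]_(j < k) F j.
Definition max_over F : R := \big[Num.max/head 0 (codom F)]_(j < k) F j.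

Lemma head_codomP F : (0 < k)%N -> exists j, head 0 (codom F) = F j.
Proof.
move=> k0; have : head 0 (codom F) \in codom F.
  have : (0 < size (codom F))%N by rewrite size_codom card_ord.
  by case: (codom F) => //= y s _; rewrite mem_head.
by move=> /codomP[j ->]; exists j.
Qed.

Lemma min_over_le F j : min_over F <= F j.
Proof. exact: bigmin_le. Qed.

Lemma min_over_attained F : (0 < k)%N -> exists j, min_over F = F j.
Proof.
move=> k0; rewrite /min_over; apply: (big_ind (fun y => exists j, y = F j)); first exact: head_codomP.
- by move=> _ _ [i ->] [j ->]; case: leP => _; [exists i | exists j].
- by move=> i _; exists i.
Qed.

Lemma max_over_ge F j : F j <= max_over F.
Proof. exact: le_bigmax. Qed.

Lemma max_over_attained F : (0 < k)%N -> exists j, max_over F = F j.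
Proof.
move=> k0; rewrite /max_over; apply: (big_ind (fun y => exists j, y = F j)); first exact: head_codomP.
- by move=> _ _ [i ->] [j ->]; case: leP => _; [exists j | exists i].
- by move=> i _; exists i.
Qed.

End FiniteExtrema.

(* The norm `|_| that the library puts on matrices is the sup norm. *)
Definition enorm (R : realType) (n : nat) (v : 'cV[R]_n) : R :=
  Num.sqrt (\sum_(l < n) v l 0 ^+ 2).

Definition eclosed_ball (R : realType) (n : nat) (c : 'cV[R]_n) (r : R) :
    set 'cV[R]_n :=
  [set y | enorm (y - c) <= r].

(* Neighbourhoods in 'M[R]_(n, k) are those of the sup norm, hence of any norm
   on R^(n x k). *)
Definition local_minimizer (R : realType) (T : topologicalType) (g : T -> R)
    (x : T) : Prop :=
  \forall y \near x, g x <= g y.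

Section Clustering.
Variables (R : realType) (n m k : nat).
Variable a : 'I_m -> 'cV[R]_n.
Implicit Types (x : 'M[R]_(n, k)) (i p : 'I_m) (j q : 'I_k).

Definition objective x : R :=
  m%:R^-1 * \sum_(i < m) min_over (fun j => enorm (a i - col j x) ^+ 2).

Definition local_solution x : Prop := local_minimizer objective x.

Definition pairwise_distinct x : Prop :=
  forall j1 j2, j1 <> j2 -> col j1 x <> col j2 x.

Definition nontrivial_local_solution x : Prop :=
  local_solution x /\ pairwise_distinct x.

Definition attraction_set x j : set 'cV[R]_n :=
  [set v | range a v /\
           enorm (v - col j x) = min_over (fun q => enorm (v - col q x))].

Definition attraction_index x j : {set 'I_m} :=
  [set i | a i \in attraction_set x j]%SET.

Definition attraction_balls x : set 'cV[R]_n :=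
  \bigcup_(p in [set: 'I_m]) \bigcup_(q in [set q | p \in attraction_index x q])
    eclosed_ball (a p) (enorm (a p - col q x)).

Definition hsum x i j : R := \sum_(q < k | q != j) enorm (a i - col q x) ^+ 2.

Definition phimax x i : R := max_over (hsum x i).

Definition active_index x i : {set 'I_k} := [set j | hsum x i j == phimax x i]%SET.

End Clustering.

(* Main.v *)
Require Import Defs.
From HB Require Import structures.
From mathcomp Require Import all_boot all_order all_algebra.
From mathcomp Require Import all_classical all_reals all_analysis.
From mathcomp Require Import ring.

Import Order.TTheory GRing.Theory Num.Theory.
Import numFieldNormedType.Exports.

Local Open Scope classical_set_scope.
Local Open Scope ring_scope.

(** A single active index at [i] means that the data point [a i] has a
    strictly closest component of [x], of index [s i] say: [hsum x i j] is the
    sum of all squared distances minus the [j]-th one, so maximizing it over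
    [j] is minimizing the distance ([strictly_closestP]). The clusters are then
    exactly the fibres of [s] ([attraction_indexE]).

    Finitely many strict inequalities between continuous functions survive a
    small perturbation, so for [y] near [x] the closest component of [y] to
    [a i] still has index [s i] ([near_argmin]). Hence near [x] the nonsmooth
    objective coincides with the smooth function
    [y |-> 1/m * \sum_i |a i - y^(s i)|^2], which splits as a sum over the
    clusters [s i = j]. On each cluster, the sum of squared distances to a point
    is globally minimized by the barycenter ([barycenter_min]), which is [x^j];
    an empty cluster contributes the constant 0. *)

Lemma enorm_sqr (R : realType) (n : nat) (v : 'cV[R]_n) :
  enorm v ^+ 2 = \sum_(l < n) v l 0 ^+ 2.
Proof. by rewrite /enorm sqr_sqrtr// sumr_ge0// => l _; rewrite sqr_ge0. Qed.

Lemma ltr_enorm_sqr (R : realType) (n : nat) (u v : 'cV[R]_n) :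
  (enorm u ^+ 2 < enorm v ^+ 2) = (enorm u < enorm v).
Proof. by rewrite ltr_pXn2r// nnegrE sqrtr_ge0. Qed.

Lemma min_over_eq (R : realType) (k : nat) (F : 'I_k -> R) (s : 'I_k) :
  (forall j, F s <= F j) -> min_over F = F s.
Proof.
move=> sF; apply/eqP; rewrite eq_le min_over_le /=.
have [j ->] := min_over_attained F (leq_ltn_trans (leq0n s) (ltn_ord s)).
exact: sF.
Qed.

Lemma strictly_closestP {R : realType} {n m k : nat}
    {a : 'I_m -> 'cV[R]_n} {x : 'M[R]_(n, k)} {i : 'I_m} :
  #|active_index a x i| = 1%N ->
  exists s, forall j, j != s ->
    enorm (a i - col s x) < enorm (a i - col j x).
Proof.
move=> /eqP/cards1P[s actE]; exists s => j js.
have hE q : hsum a x i q =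
    \sum_(r < k) enorm (a i - col r x) ^+ 2 - enorm (a i - col q x) ^+ 2.
  by rewrite (bigD1 q)//= addrAC subrr add0r.
have smax : hsum a x i s = phimax a x i.
  have : s \in active_index a x i by rewrite actE set11.
  by rewrite inE => /eqP.
have : hsum a x i j < phimax a x i.
  rewrite lt_neqAle max_over_ge andbT.
  have : j \notin active_index a x i by rewrite actE inE.
  by rewrite inE.
by rewrite -smax !hE ltrD2l ltrN2 ltr_enorm_sqr.
Qed.

Lemma attraction_indexE {R : realType} {n m k : nat}
    {a : 'I_m -> 'cV[R]_n} {x : 'M[R]_(n, k)} {i : 'I_m} {s} (j : 'I_k) :
  (forall q, q != s -> enorm (a i - col s x) < enorm (a i - col q x)) ->
  (i \in attraction_index a x j) = (s == j).
Proof.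
move=> closest.
have minE : min_over (fun q => enorm (a i - col q x)) = enorm (a i - col s x).
  apply: (@min_over_eq _ _ (fun q => enorm (a i - col q x))) => q.
  by have [->//|/closest/ltW] := eqVneq q s.
rewrite inE; apply/idP/eqP => [|<-].
  rewrite in_setE => -[_]; rewrite minE => dE.
  by apply/eqP; apply: contraT; rewrite eq_sym => /closest; rewrite dE ltxx.
by rewrite in_setE; split; [exists i | rewrite minE].
Qed.

(** Coordinatewise this is the identity
    [\sum (a - t)^2 = \sum (a - c)^2 + |A| (c - t)^2], valid when [c] is the mean
    of the [a]'s because the cross term [2 (c - t) \sum (a - c)] vanishes. *)
Lemma barycenter_min (R : realType) (n : nat) (I : finType) (A : {set I})
    (a : I -> 'cV[R]_n) (c y : 'cV[R]_n) :
  #|A|%:R *: c = \sum_(i in A) a i ->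
  \sum_(i in A) enorm (a i - c) ^+ 2 <= \sum_(i in A) enorm (a i - y) ^+ 2.
Proof.
move=> cE; under eq_bigr do rewrite enorm_sqr.
under [leRHS]eq_bigr do rewrite enorm_sqr.
rewrite exchange_big [leRHS]exchange_big /=; apply: ler_sum => l _.
have cross0 : \sum_(i in A) (a i l 0 - c l 0) = 0.
  rewrite sumrB sumr_const -mulr_natl.
  by move/matrixP/(_ l 0): cE; rewrite summxE !mxE => ->; rewrite subrr.
rewrite [leRHS](_ : _ = \sum_(i in A) ((a i - c) l 0 ^+ 2
  + (a i l 0 - c l 0) * (2 * (c l 0 - y l 0)) + (c l 0 - y l 0) ^+ 2)); last first.
  by apply: eq_bigr => i _; rewrite !mxE; ring.
rewrite !big_split /= -mulr_suml cross0 mul0r addr0 lerDl.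
by apply: sumr_ge0 => i _; rewrite sqr_ge0.
Qed.

Lemma continuous_sqdist (R : realType) (n k : nat) (v : 'cV[R]_n) (j : 'I_k) :
  continuous (fun y : 'M[R]_(n, k) => enorm (v - col j y) ^+ 2).
Proof.
rewrite (_ : (fun y => _) = (fun y : 'M[R]_(n, k) =>
    \sum_(l < n) (v l 0 - y l j) * (v l 0 - y l j))); last first.
  apply/funext => y; rewrite enorm_sqr.
  by apply: eq_bigr => l _; rewrite !mxE expr2.
apply: continuous_big => [|l _ x]; first exact: add_continuous.
have vy : {for x, continuous (fun y : 'M[R]_(n, k) => v l 0 - y l j)}.
  by apply: continuousB; [exact: cst_continuous | exact: coord_continuous].
exact: (continuousM vy vy).
Qed.

(** Strict minimality is finitely many strict inequalities between functions
    continuous at [x], each of which persists on a neighbourhood of [x]. *)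
Lemma near_argmin (R : realType) (T : topologicalType) (I J : finType)
    (F : I -> J -> T -> R) (x : T) (s : I -> J) :
  (forall i j, {for x, continuous (F i j)}) ->
  (forall i j, j != s i -> F i (s i) x < F i j x) ->
  \forall y \near x, forall i j, F i (s i) y <= F i j y.
Proof.
move=> F_cont s_min; apply: filter_forall => i; apply: filter_forall => j.
have [->|js] := eqVneq j (s i); first by near=> y.
have gap_cont : {for x, continuous (F i j - F i (s i))}.
  exact: continuousB.
have gap_gt0 : 0 < (F i j - F i (s i)) x by rewrite subr_gt0 s_min.
near=> y; apply: ltW; rewrite -subr_gt0.
by near: y; exact: cvgr_gt gap_cont _ gap_gt0.
Unshelve. all: by end_near. Qed.

Theorem theorem4 (R : realType) (n m k : nat)
  (n_gt0 : (0 < n)%N) (m_gt0 : (0 < m)%N) (k_gt0 : (0 < k)%N)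
  (k_le_m : (k <= m)%N)
  (a : 'I_m -> 'cV[R]_n) (x : 'M[R]_(n, k))
  (x_distinct : pairwise_distinct x)
  (active_card1 : forall i : 'I_m, #|active_index a x i| = 1%N)
  (x_mean : forall j : 'I_k, attraction_set a x j <> set0 ->
     col j x = #|attraction_index a x j|%:R^-1
                 *: \sum_(i in attraction_index a x j) a i)
  (x_far : forall j : 'I_k, attraction_set a x j = set0 ->
     ~ attraction_balls a x (col j x)) :
  nontrivial_local_solution a x.
Proof.
split=> //.
have [s closest] := choice (fun i => strictly_closestP (active_card1 i)).
pose sqdist i j (y : 'M[R]_(n, k)) := enorm (a i - col j y) ^+ 2.
have near_x :
    \forall y \near x, forall i j, sqdist i (s i) y <= sqdist i j y.
  apply: near_argmin => [i j|i j js]; first exact: continuous_sqdist.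
  by rewrite ltr_enorm_sqr closest.
have objE y : (forall i j, sqdist i (s i) y <= sqdist i j y) ->
  objective a y = m%:R^-1 * \sum_(j < k)
    \sum_(i in attraction_index a x j) enorm (a i - col j y) ^+ 2.
  move=> ys; congr (_ * _).
  rewrite (partition_big s xpredT)//=; apply: eq_bigr => j _.
  apply: eq_big => [i|i /eqP <-].
    by rewrite (attraction_indexE _ (closest i)).
  exact: (@min_over_eq _ _ (sqdist i ^~ y)).
have objx := objE x (nbhs_singleton near_x).
apply: (@filterS _ (nbhs x) _ _ _ _ near_x) => y /objE ->; rewrite objx.
rewrite ler_wpM2l ?invr_ge0//; apply: ler_sum => j _.
apply: barycenter_min.
have [->|[i0 i0j]] := set_0Vmem (attraction_index a x j).
  by rewrite cards0 scale0r big_set0.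
rewrite x_mean; last first.
  by move: i0j; rewrite inE in_setE => i0j A0; rewrite A0 in i0j.
rewrite scalerA divff ?scale1r// pnatr_eq0 -lt0n.
by apply/card_gt0P; exists i0.
Qed.
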